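(* Let $\overrightarrow{G}=(V,E)$ be a strongly connected digraph on $n$ vertices with vertex set $V=\{v_1,\ldots,v_n\}$, and let $d_i^+$ denote the out-degree of $v_i$. Then $$\mu(\overrightarrow{G})\leq \max_{1\leq i\leq n}\Bigg\{d_i^+ +\sqrt{\sum_{j\sim i} d_j^+}\Bigg\},$$ where $\sum_{j\sim i}$ denotes the sum over all $j$ such that $(v_j,v_i)\in E$. If equality holds, then $$d_1^+ +\sqrt{\sum_{j\sim 1} d_j^+}=d_2^+ +\sqrt{\sum_{j\sim 2} d_j^+}=\cdots=d_n^+ +\sqrt{\sum_{j\sim n} d_j^+}.$$
   Context: Digraphs are finite and simple (no loops, no multiple arcs). A digraph is strongly connected if for every pair of vertices $v_i,v_j$ there are directed paths from $v_i$ to $v_j$ and from $v_j$ to $v_i$. The notation $i\sim j$ means that the arc $(v_i,v_j)$ belongs to $E$. The out-degree $d_i^+$ is the number of vertices $v_j$ with $(v_i,v_j)\in E$. The adjacency matrix $A(\overrightarrow{G})=(a_{ij})$ has $a_{ij}=1$ if $(v_i,v_j)\in E$ and $a_{ij}=0$ otherwise. The Laplacian matrix is $L(\overrightarrow{G})=\mathrm{diag}(d_1^+,\ldots,d_n^+)-A(\overrightarrow{G})$, and the Laplacian spectral radius $\mu(\overrightarrow{G})$ is the spectral radius of $L(\overrightarrow{G})$, i.e. the largest modulus of its (complex) eigenvalues. *)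

(* Defs.v *)
From HB Require Import structures.
From mathcomp Require Import all_boot all_order all_algebra.
From mathcomp Require Import all_classical all_reals.
From mathcomp Require Import complex.

Set Implicit Arguments.
Unset Strict Implicit.
Unset Printing Implicit Defensive.

Import Order.TTheory GRing.Theory Num.Theory.
Local Open Scope ring_scope.

(* A simple digraph on the vertex set 'I_n is an irreflexive [e : rel 'I_n];
   [e i j] means that there is an arc from i to j. *)
Definition strongly_connected (n : nat) (e : rel 'I_n) : Prop :=
  forall i j : 'I_n, connect e i j /\ connect e j i.

Definition outdeg (n : nat) (e : rel 'I_n) (i : 'I_n) : nat :=
  #|[set j | e i j]|.

Definition adjmx (K : pzRingType) (n : nat) (e : rel 'I_n) : 'M[K]_n :=
  \matrix_(i, j) (e i j)%:R.

Definition laplacian (K : pzRingType) (n : nat) (e : rel 'I_n) : 'M[K]_n :=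
  diag_mx (\row_i (outdeg e i)%:R) - adjmx K e.

(* [complex.Re `|z|] is the modulus of z as an element of R: the norm of R[i]
   takes values in R[i]. MathComp's [eigenvalue] refers to row eigenvectors;
   the eigenvalues are the same as for column eigenvectors. *)
Definition eigen_moduli (R : realType) (n : nat) (A : 'M[R[i]]_n) : set R :=
  [set complex.Re `|z| | z in [set z : R[i] | eigenvalue A z]]%classic.

(* For n > 0 this supremum is a maximum: see [spectral_radius_max]. *)
Definition spectral_radius (R : realType) (n : nat) (A : 'M[R[i]]_n) : R :=
  sup (eigen_moduli A).

Definition laplacian_radius (R : realType) (n : nat) (e : rel 'I_n) : R :=
  spectral_radius (laplacian R[i] e).

(* The sum is over the in-neighbours j of i. The bound is nonnegative, so 0 is a
   harmless default value for its maximum over the vertices. *)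
Definition vertex_bound (R : realType) (n : nat) (e : rel 'I_n) (i : 'I_n) : R :=
  (outdeg e i)%:R + Num.sqrt (\sum_(j < n | e j i) (outdeg e j)%:R).

Lemma spectral_radius_max (R : realType) (n : nat) (A : 'M[R[i]]_n) :
  (0 < n)%N ->
  eigen_moduli A (spectral_radius A) /\
  (forall z : R[i], eigenvalue A z -> complex.Re `|z| <= spectral_radius A).
Proof.
case: n A => // n A _.
have [r Er] := closed_field_poly_normal (char_poly A).
move: Er; rewrite (monicP (char_poly_monic A)) scale1r => Er.
have eigE z : eigenvalue A z = (z \in r).
  by rewrite eigenvalue_root_char Er root_prod_XsubC.
have r0 : (0 < size r)%N.
  by have := size_char_poly A; rewrite Er size_prod_XsubC => -[->].
pose f (z : R[i]) : R := complex.Re `|z|.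
have [z zr zmax] : exists2 z, z \in r & {in r, forall w, f w <= f z}.
  elim: r r0 {Er eigE} => // a [|b s] IHs _.
    by exists a => [|w]; rewrite ?inE // => /eqP ->.
  have [//|z zs zmax] := IHs.
  have [le_az|lt_za] := leP (f a) (f z).
    exists z => [|w]; first by rewrite inE zs orbT.
    by rewrite inE => /orP[/eqP ->//|/zmax].
  exists a => [|w]; first by rewrite inE eqxx.
  by rewrite inE => /orP[/eqP ->//|/zmax/le_trans]; apply; apply: ltW.
have ubz : ubound (eigen_moduli A) (f z).
  by move=> _ [w /= Aw <-]; apply: zmax; rewrite -eigE.
have Sz : eigen_moduli A (f z) by exists z => //=; rewrite eigE.
have -> : spectral_radius A = f z.
  apply/eqP; rewrite eq_le; apply/andP; split.
    by apply: ge_sup => //; exists (f z).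
  by apply: ub_le_sup => //; exists (f z).
by split=> // w Aw; apply: ubz; exists w.
Qed.

(* Main.v *)
Require Import Defs.
From HB Require Import structures.
From mathcomp Require Import all_boot all_order all_algebra.
From mathcomp Require Import all_classical all_reals.
From mathcomp Require Import complex.
From mathcomp Require Import ring lra.

(** Let x be a column eigenvector of the Laplacian for the eigenvalue z, d_i the
    out-degree of i and S_i the sum of the out-degrees of the in-neighbours of i.
    The i-th row of L x = z x reads
      (z - d_i) x_i = - sum_(i -> j) x_j,
    and Cauchy-Schwarz on its d_i terms gives
      |z - d_i|^2 |x_i|^2 <= d_i sum_(i -> j) |x_j|^2
    ([laplacian_row_le]). Summed over i, the right-hand sides collect |x_j|^2
    with coefficient S_j ([sum_outdeg_outnbr]), so
      sum_i (|z - d_i|^2 - S_i) |x_i|^2 <= 0.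

    Suppose now that d_i + sqrt S_i <= |z| for every i. Then
    |z - d_i| >= |z| - d_i >= sqrt S_i, every term of this sum is nonnegative,
    and both the terms and the gaps in the row inequalities must vanish. The
    vanishing gaps show that x_i = 0 forces x_j = 0 whenever i -> j; by strong
    connectivity x, being nonzero, has no zero entry. The vanishing terms then
    give |z - d_i| = sqrt S_i, hence d_i + sqrt S_i = |z| for every i
    ([vertex_bound_eq_modulus]).

    Both claims follow: |z| cannot exceed all the vertex bounds strictly, and if
    it equals their maximum then they all coincide. *)

Set Implicit Arguments.
Unset Strict Implicit.
Unset Printing Implicit Defensive.

Import Order.TTheory GRing.Theory Num.Theory.
Import ComplexField.Normc.
Local Open Scope ring_scope.

(** The eigenvalues of a matrix are defined by row eigenvectors; column ones
    exist as well because a square matrix is singular iff its transpose is. *)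
Lemma eigenvalue_col (F : fieldType) (n : nat) (A : 'M[F]_n) (z : F) :
  eigenvalue A z -> exists2 x : 'cV[F]_n, A *m x = z *: x & x != 0.
Proof.
rewrite /eigenvalue /eigenspace kermx_eq0 row_free_unit -unitmx_tr.
rewrite -row_free_unit -kermx_eq0 => /rowV0Pn [v /sub_kermxP vA v0].
exists v^T; last by rewrite -(inj_eq trmx_inj) trmxK trmx0.
apply/eqP; rewrite -subr_eq0 -mul_scalar_mx -mulmxBl.
by rewrite -(inj_eq trmx_inj) trmx_mul trmxK vA trmx0.
Qed.

(** Expanding the square and bounding each product by the mean of two squares
    gives Cauchy-Schwarz against the constant vector 1. *)
Lemma sqr_sum_le (R : realFieldType) (I : finType) (P : pred I) (a : I -> R) :
  (\sum_(i | P i) a i) ^+ 2 <= #|P|%:R * \sum_(i | P i) a i ^+ 2.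
Proof.
set s := \sum_(i | P i) a i; set q := \sum_(i | P i) a i ^+ 2.
have -> : s ^+ 2 = \sum_(i | P i) \sum_(j | P j) a i * a j.
  by rewrite expr2 mulr_suml; apply: eq_bigr => i _; rewrite mulr_sumr.
have -> : #|P|%:R * q
    = \sum_(i | P i) \sum_(j | P j) (a i ^+ 2 + a j ^+ 2) / 2.
  under eq_bigr => i _ do rewrite -mulr_suml big_split /= sumr_const -/q.
  rewrite -mulr_suml big_split /= sumr_const -sumrMnl -/q -mulr_natl.
  under eq_bigr do rewrite -mulr_natl.
  by rewrite -mulr_sumr -/q; field.
apply: ler_sum => i _; apply: ler_sum => j _.
by have := sqr_ge0 (a i - a j); lra.
Qed.

Lemma modulusE (R : realType) (z : R[i]) : complex.Re `|z| = normc z.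
Proof. by case: z. Qed.

Lemma normc_ge0 (R : realType) (z : R[i]) : 0 <= normc z.
Proof. by case: z => a b; rewrite sqrtr_ge0. Qed.

Lemma normc_sum_le (R : realType) (I : finType) (P : pred I) (x : I -> R[i]) :
  normc (\sum_(i | P i) x i) <= \sum_(i | P i) normc (x i).
Proof.
elim/big_ind2: _ => [|z s w t zs wt|//]; first by rewrite normc0.
by apply: le_trans (le_normcD _ _) _; apply: lerD.
Qed.

Lemma normc_nat (R : realType) (k : nat) : normc (k%:R : R[i]) = k%:R.
Proof. by rewrite normcMn normc1. Qed.

Section Laplacian.
Variables (R : realType) (n : nat) (e : rel 'I_n).

Let d (i : 'I_n) : R := (outdeg e i)%:R.
Let S (i : 'I_n) : R := \sum_(j < n | e j i) d j.

Lemma laplacian_mul_col (K : pzRingType) (x : 'cV[K]_n) (i : 'I_n) :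
  (laplacian K e *m x) i 0
    = (outdeg e i)%:R * x i 0 - \sum_(j < n | e i j) x j 0.
Proof.
rewrite mulmxBl mul_diag_mx !mxE; congr (_ - _).
rewrite [RHS]big_mkcond; apply: eq_bigr => j _; rewrite mxE.
by case: (e i j); rewrite (mul1r, mul0r).
Qed.

Lemma laplacian_row_le (z : R[i]) (x : 'cV[R[i]]_n) :
  laplacian R[i] e *m x = z *: x -> forall i,
  (normc (z - (outdeg e i)%:R) * normc (x i 0)) ^+ 2
    <= d i * \sum_(j < n | e i j) normc (x j 0) ^+ 2.
Proof.
move=> Lx i; rewrite -normcM.
have -> : (z - (outdeg e i)%:R) * x i 0 = - \sum_(j < n | e i j) x j 0.
  have := laplacian_mul_col x i; rewrite Lx mxE mulrBl => ->.
  by rewrite addrAC subrr add0r.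
rewrite normcN.
apply: (le_trans (y := (\sum_(j < n | e i j) normc (x j 0)) ^+ 2)).
  by rewrite lerXn2r ?nnegrE ?normc_ge0 ?normc_sum_le // sumr_ge0 // => j _;
     exact: normc_ge0.
have -> : d i = #|e i|%:R by rewrite /d /outdeg cardsE.
exact: sqr_sum_le.
Qed.

Lemma sum_outdeg_outnbr (b : 'I_n -> R) :
  \sum_i d i * (\sum_(j < n | e i j) b j) = \sum_i S i * b i.
Proof.
under eq_bigr do rewrite mulr_sumr.
rewrite (exchange_big_dep xpredT) //=.
by apply: eq_bigr => i _; rewrite -mulr_suml.
Qed.

Lemma connect_propagate (P : 'I_n -> Prop) :
  (forall i j, e i j -> P i -> P j) ->
  forall i j, connect e i j -> P i -> P j.
Proof.
move=> stepP i j /connectP [p + ->].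
by elim: p i => //= k p IHp i /andP[eik pk] /(stepP _ _ eik); exact: IHp.
Qed.

(** Both the bound and its equality case come from this extremal situation, in
    which nonnegative slacks and terms add up to 0, so that no inequality in the
    argument is strict at any vertex. *)
Lemma vertex_bound_eq_modulus (z : R[i]) :
  strongly_connected e -> eigenvalue (laplacian R[i] e) z ->
  (forall i, vertex_bound R e i <= complex.Re `|z|) ->
  forall i, vertex_bound R e i = complex.Re `|z|.
Proof.
move=> e_sc /eigenvalue_col [x Lx x0]; rewrite modulusE => le_z.
pose a i := normc (x i 0); pose q i := normc (z - (outdeg e i)%:R).
have S0 i : 0 <= S i by apply: sumr_ge0 => j _; rewrite ler0n.
have q_ge i : normc z - d i <= q i.
  rewrite lerBlDr /q /d -(normc_nat R (outdeg e i)).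
  by apply: le_trans (le_normcD _ _); rewrite subrK.
have sqrtS_le i : Num.sqrt (S i) <= normc z - d i.
  by rewrite lerBrDl; exact: le_z.
have term_ge0 i : 0 <= (q i ^+ 2 - S i) * a i ^+ 2.
  rewrite mulr_ge0 ?sqr_ge0 // subr_ge0 -[S i]sqr_sqrtr //.
  rewrite lerXn2r ?nnegrE ?sqrtr_ge0 ?normc_ge0 //.
  exact: le_trans (sqrtS_le i) (q_ge i).
pose gap i := d i * (\sum_(j < n | e i j) a j ^+ 2) - (q i * a i) ^+ 2.
have gap_ge0 i : 0 <= gap i by rewrite subr_ge0; exact: laplacian_row_le.
(* In each summand the q i ^+ 2 parts cancel; what is left vanishes in total
   because both of its parts count every arc, weighted alike. *)
have sum0 : \sum_i (gap i + (q i ^+ 2 - S i) * a i ^+ 2) = 0.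
  have addE i : gap i + (q i ^+ 2 - S i) * a i ^+ 2
      = d i * (\sum_(j < n | e i j) a j ^+ 2) - S i * a i ^+ 2.
    by rewrite /gap; ring.
  under eq_bigr do rewrite addE.
  by rewrite sumrB sum_outdeg_outnbr subrr.
have both0 i : gap i = 0 /\ (q i ^+ 2 - S i) * a i ^+ 2 = 0.
  have /eqP : gap i + (q i ^+ 2 - S i) * a i ^+ 2 = 0.
    by apply: (psumr_eq0P _ sum0) => // j _; apply: addr_ge0.
  rewrite paddr_eq0 ?gap_ge0 ?term_ge0 //.
  by move=> /andP[/eqP -> /eqP ->].
have a_step i j : e i j -> a i = 0 -> a j = 0.
  move=> eij ai0; have [+ _] := both0 i.
  rewrite /gap ai0 mulr0 expr0n subr0 => /eqP; rewrite mulf_eq0.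
  (* An arc leaves i, so the factor d i can be cancelled. *)
  have /negPf -> : d i != 0.
    by rewrite pnatr_eq0 -lt0n; apply/card_gt0P; exists j; rewrite inE.
  move=> /= /eqP sum_a0.
  have := psumr_eq0P (fun k _ => sqr_ge0 (a k)) sum_a0 eij.
  by move=> /eqP; rewrite sqrf_eq0 => /eqP.
have a_neq0 i : a i != 0.
  apply: contra x0 => /eqP ai0; apply/eqP/matrixP => j k; rewrite ord1 mxE.
  apply: eq0_normc.
  by have [cij _] := e_sc i j; exact: (connect_propagate a_step cij ai0).
move=> i; have [_ /eqP] := both0 i.
rewrite mulf_eq0 sqrf_eq0 (negPf (a_neq0 i)) orbF subr_eq0 => /eqP qS.
have q_eq : q i = Num.sqrt (S i) by rewrite -qS sqrtr_sqr ger0_norm ?normc_ge0.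
by apply: le_anti; rewrite le_z /= -lerBlDl -/(d i) (le_trans (q_ge i)) ?q_eq.
Qed.

End Laplacian.

Theorem theorem4p2 (R : realType) (n : nat) (n_gt0 : (0 < n)%N)
    (e : rel 'I_n) (e_irr : irreflexive e) (e_sc : strongly_connected e) :
  laplacian_radius R e <= \big[Num.max/0]_(i < n) vertex_bound R e i
  /\ (laplacian_radius R e = \big[Num.max/0]_(i < n) vertex_bound R e i ->
      forall i j : 'I_n, vertex_bound R e i = vertex_bound R e j).
Proof.
have [[z Lz mz] _] := spectral_radius_max (laplacian R[i] e) n_gt0.
have {mz} mz : complex.Re `|z| = laplacian_radius R e by [].
have le_max i : vertex_bound R e i <= \big[Num.max/0]_(i < n) vertex_bound R e i.
  exact: le_bigmax.
have bound_eq_radius : \big[Num.max/0]_(i < n) vertex_bound R e i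
    <= laplacian_radius R e ->
    forall i, vertex_bound R e i = laplacian_radius R e.
  move=> le_r i; rewrite -mz; apply: vertex_bound_eq_modulus => // j.
  by rewrite mz; exact: le_trans (le_max j) le_r.
split; last first.
  by move=> r_eq i j; rewrite !bound_eq_radius // r_eq.
rewrite leNgt; apply/negP => max_lt.
have := le_max (Ordinal n_gt0).
by rewrite (bound_eq_radius (ltW max_lt)) leNgt max_lt.
Qed.
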